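(* (In $\mathsf{ZFC}$.) There is a $\trianglelefteq$-antichain of $\aleph_1$-dense Aronszajn lines of size $2^{\aleph_1}$; that is, there is a family of $2^{\aleph_1}$ many $\aleph_1$-dense Aronszajn lines such that for any two distinct members $A,B$ of the family neither $A\trianglelefteq B$ nor $B\trianglelefteq A$.
   Context: $A\trianglelefteq B$ means that $A=\varnothing$ or there is an epimorphism from $B$ onto $A$, i.e. a surjective monotone map $f:B\to A$ ($x\le y$ implies $f(x)\le f(y)$). An Aronszajn line is an uncountable linear order containing no copy of $\omega_1$, of its reverse $\omega_1^{\star}$, or of any uncountable set of reals. A nonempty linear order $A$ is $\aleph_1$-dense if it has no left or right endpoint and $[a,b]_A$ has size $\aleph_1$ for all $a<_A b$. *)

(* Defs.v *)
From HB Require Import structures.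
From mathcomp Require Import all_boot all_order all_algebra.
From mathcomp Require Import all_classical reals.
From mathcomp Require wochoice.

Set Implicit Arguments.
Unset Strict Implicit.
Unset Printing Implicit Defensive.
Import Order.TTheory.

Local Open Scope classical_set_scope.
Local Open Scope order_scope.
Local Open Scope card_scope.

(* A concrete type of order type omega_1: choose a well-order of [set nat] and  *)
(* cut it at the first point with uncountably many predecessors, if any.  The   *)
(* lemmas [omega1_wf], [omega1_uncountable] and [omega1_initial_countable] pin  *)
(* the result down up to isomorphism.                                           *)

Lemma set_nat_uncountable : ~ countable [set: set nat].
Proof.
move=> /countable_injP[f finj].
pose D := [set n | exists2 A : set nat, f A = n & ~ A n].
have DP : ~ D (f D).
  move=> DfD; case: (DfD) => A fAD; apply.
  by rewrite (finj A D) ?inE.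
by apply: (DP); exists D.
Qed.

Definition set_nat_wo : rel (set nat) :=
  sval (wochoice.well_ordering_principle (set nat)).

Lemma set_nat_woP : wochoice.well_order set_nat_wo.
Proof. exact: svalP (wochoice.well_ordering_principle (set nat)). Qed.

Lemma set_nat_wo_min (A : set (set nat)) : A !=set0 ->
  exists2 x, A x & forall y, A y -> set_nat_wo x y.
Proof.
move=> [a Aa]; have [|x [[xA xmin] _]] := @set_nat_woP (fun z => z \in A).
  by exists a; rewrite unfold_in; exact: mem_set.
by exists x => [|y Ay]; [exact: set_mem | apply: xmin; rewrite unfold_in; exact: mem_set].
Qed.

Lemma set_nat_wo_total : total set_nat_wo.
Proof.
move=> x y; have [|z [->|->] zmin] := @set_nat_wo_min [set x; y].
- by exists x; left.
- by rewrite zmin //; right.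
- by rewrite (zmin x) ?orbT //; left.
Qed.

Lemma set_nat_wo_refl : reflexive set_nat_wo.
Proof. by move=> x; have := set_nat_wo_total x x; rewrite orbb. Qed.

Lemma set_nat_wo_anti : antisymmetric set_nat_wo.
Proof.
move=> x y /andP[xy yx].
have [|z [_ zuniq]] := @set_nat_woP (fun t => (t == x) || (t == y)).
  by exists x; rewrite unfold_in eqxx.
have zE t : t \in [:: x; y] -> z = t.
  rewrite mem_seq2 => txy; apply: zuniq; split=> // u /orP[]/eqP ->;
    case/orP: txy => /eqP ->; do ?exact: set_nat_wo_refl; assumption.
by rewrite -(zE x) ?(zE y) // !inE eqxx ?orbT.
Qed.

Lemma set_nat_wo_trans : transitive set_nat_wo.
Proof.
move=> y x z xy yz.
have [|t tS tmin] := @set_nat_wo_min [set t | [\/ t = x, t = y | t = z]].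
  by exists x; constructor 1.
have tx : set_nat_wo t x by apply: tmin; constructor 1.
have ty : set_nat_wo t y by apply: tmin; constructor 2.
have tz : set_nat_wo t z by apply: tmin; constructor 3.
case: tS => E; subst t => //.
- by rewrite (@set_nat_wo_anti x y) ?xy.
- by rewrite -(@set_nat_wo_anti y z) ?yz ?ty.
Qed.

Lemma omega1_subset_ex : exists D : set (set nat), ~ countable D /\
  forall x, D x -> countable [set y | D y /\ set_nat_wo y x].
Proof.
pose U := [set x | ~ countable [set y | set_nat_wo y x]].
have [/set_nat_wo_min[x Ux xmin]|U0] := pselect (U !=set0); last first.
  exists [set: set nat]; split; first exact: set_nat_uncountable.
  move=> x _; apply: contrapT => xU; apply: U0; exists x => xc; apply: xU.
  by apply: sub_countable xc; apply: subset_card_le => y [].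
exists [set y | set_nat_wo y x /\ y <> x]; split.
  move=> c; apply: Ux; apply: sub_countable (_ : countable
    (\bigcup_(b in [set: bool])
       if b then [set x] else [set y | set_nat_wo y x /\ y <> x])).
    apply: subset_card_le => y yx; have [->|yNx] := pselect (y = x).
      by exists true.
    by exists false.
  by apply: bigcup_countable => // -[].
move=> y [yx yNx]; apply: contrapT => yc; apply: yNx; apply: set_nat_wo_anti.
rewrite yx; apply: xmin => c; apply: yc.
by apply: sub_countable c; apply: subset_card_le => z [].
Qed.

Definition omega1_subset : set (set nat) := sval (cid omega1_subset_ex).

Definition omega1 : Type := {x : set nat | x \in omega1_subset}.

HB.instance Definition _ := [isSub of omega1 for @sval _ _].
HB.instance Definition _ := [Choice of omega1 by <:].

Fact omega1_display : Order.disp_t. Proof. exact: Order.default_display. Qed.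

Definition omega1_le : rel omega1 := fun x y => set_nat_wo (val x) (val y).

Lemma omega1_le_refl : reflexive omega1_le.
Proof. by move=> x; exact: set_nat_wo_refl. Qed.

Lemma omega1_le_anti : antisymmetric omega1_le.
Proof. by move=> x y /set_nat_wo_anti/val_inj. Qed.

Lemma omega1_le_trans : transitive omega1_le.
Proof. by move=> y x z; exact: set_nat_wo_trans. Qed.

Lemma omega1_le_total : total omega1_le.
Proof. by move=> x y; exact: set_nat_wo_total. Qed.

HB.instance Definition _ := Order.Le_isPOrder.Build omega1_display omega1
  omega1_le_refl omega1_le_anti omega1_le_trans.
HB.instance Definition _ :=
  Order.POrder_isTotal.Build omega1_display omega1 omega1_le_total.

Lemma omega1_wf (A : set omega1) : A !=set0 ->
  exists2 x, A x & forall y, A y -> x <= y.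
Proof.
move=> [a Aa]; have [|_ [x Ax <-] xmin] := @set_nat_wo_min (val @` A).
  by exists (val a); exists a.
by exists x => // y Ay; apply: xmin; exists y.
Qed.

Lemma omega1_uncountable : ~ countable [set: omega1].
Proof.
move=> /countable_injP[f finj].
case: (svalP (cid omega1_subset_ex)) => + _; apply.
apply/countable_injP.
exists (fun x => if insub x is Some u then f u else 0%N) => x y xD yD.
rewrite !insubT => /finj; rewrite !inE => /(_ I I) E.
exact: (congr1 val E).
Qed.

Lemma omega1_initial_countable (x : omega1) : countable [set y | y < x].
Proof.
case: (svalP (cid omega1_subset_ex)) => _ /(_ (val x) (set_mem (valP x))).
move=> /countable_injP[f finj]; apply/countable_injP; exists (f \o val).
move=> y z; rewrite !inE /= => yx zx /finj.
move=> H; apply: val_inj; apply: H; rewrite inE; split.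
- exact: set_mem (valP y).
- exact: ltW yx.
- exact: set_mem (valP z).
- exact: ltW zx.
Qed.

Definition contains_copy d (B : orderType d) d' (A : orderType d') : Prop :=
  exists f : A -> B, {mono f : x y / x <= y}.

Definition epi_le d (A : orderType d) d' (B : orderType d') : Prop :=
  [set: A] = set0 \/
  exists2 f : B -> A, {homo f : x y / x <= y} & set_surj [set: B] [set: A] f.

Definition aronszajn_line (R : realType) d (A : orderType d) : Prop :=
  [/\ ~ countable [set: A],
      ~ contains_copy A omega1,
      ~ contains_copy A omega1^d &
      forall X : set R, ~ countable X ->
        ~ exists f : R -> A, {in X &, {mono f : x y / x <= y}}].

Definition aleph1_dense d (A : orderType d) : Prop :=
  [/\ [set: A] !=set0,
      ~ (exists a : A, forall x, a <= x),
      ~ (exists a : A, forall x, x <= a) &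
      forall a b : A, a < b -> [set x : A | a <= x <= b] #= [set: omega1]].

(* Main.v *)
Require Import Defs.
From HB Require Import structures.
From mathcomp Require Import all_boot all_order all_algebra.
From mathcomp Require Import all_classical reals.

(** The lines are lexicographic orders on one and the same Aronszajn tree.  Fix a
    coherent family of finite-to-one functions [rho a] from the ordinals below
    [a] to the natural numbers ([coherent_family]); the finite modifications of
    the [rho a], with rational values, form a tree [node] with countable levels
    and no cofinal branch ([no_cofinal_branch]).  For a set [S] of countable
    ordinals, [line S] orders the nodes by their first difference, where a node
    whose height is in [S] is placed below its proper extensions, and any other
    node above them.  The cone of a node (the set of its extensions) is convex,
    which makes every such line Aronszajn: a copy of omega_1 or of its reverse
    would single out a cofinal branch, and in an uncountable set of reals some
    countable subset separates points that lie in a common cone above it.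
    Since the rationals are dense without endpoints, every interval contains a
    cone, so the lines are also aleph_1-dense.

    The set [S] can be read off modulo nonstationary sets, in a way that an
    epimorphism preserves.  An epimorphism [f] from [line S] onto [line T]
    decides, for each [y], the initial segments [f s < y] and [f s <= y], and
    each of these is decided by the restriction of [s] to some countable level
    ([cut_decided]).  Let [d] be closed under these levels and under the effect
    of [f] on heights.  Then [f] respects the partition of the high nodes into
    cones of level [d].  If [d] is in [S] but not in [T], the cones of level [d]
    have least elements in [line S] and none in [line T], whereas a surjective
    monotone map sends least elements to least elements ([no_epi]).  So
    [line T] is not an epimorphic image of [line S] once the difference of [S]
    and [T] is stationary.  Finally, omega_1 contains aleph_1 many disjoint
    stationary sets, by an Ulam matrix, and suitable unions of these are
    2^aleph_1 many sets with pairwise stationary differences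
    ([stationary_antichain]). *)

Set Implicit Arguments.
Unset Strict Implicit.
Unset Printing Implicit Defensive.
Import Order.TTheory.

Local Open Scope classical_set_scope.
Local Open Scope order_scope.
Local Open Scope card_scope.

(** * Countable sets *)

Lemma countable_subset T (A B : set T) : A `<=` B -> countable B -> countable A.
Proof. by move=> AB; apply: sub_countable; exact: subset_card_le. Qed.

Lemma countable_setU T (A B : set T) :
  countable A -> countable B -> countable (A `|` B).
Proof.
move=> cA cB; rewrite -bigcup2E; apply: bigcup_countable => // -[|[|n]] _ //=.
Qed.

Lemma countable_image T U (A : set T) (f : T -> U) :
  countable A -> countable (f @` A).
Proof. by move=> cA; apply: sub_countable cA; exact: card_image_le. Qed.

Lemma countable_injective T U (A : set T) (f : T -> U) :
  {in A &, injective f} -> countable (f @` A) -> countable A.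
Proof. by move=> /inj_card_eq /eq_countable ->. Qed.

(** If the fibres over a countable set of values were all countable, so would be
    their union. *)
Lemma uncountable_fiber T U (A : set T) (N : set U) (f : T -> U) :
    ~ countable A -> countable N -> (forall x, A x -> N (f x)) ->
  exists2 n, N n & ~ countable [set x | A x /\ f x = n].
Proof.
move=> uA cN fN; apply: contrapT => noN; apply: uA.
apply: (@countable_subset _ _ (\bigcup_(n in N) [set x | A x /\ f x = n])).
  by move=> x Ax; exists (f x); [exact: fN|].
apply: bigcup_countable => // n Nn.
by apply: contrapT => ?; apply: noN; exists n.
Qed.

Lemma uncountable_setD T (A B : set T) :
  ~ countable A -> countable B -> ~ countable (A `\` B).
Proof.
move=> uA cB cD; apply: uA; apply: countable_subset (countable_setU cD cB).
by move=> x Ax; have [|] := pselect (B x); [right|left].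
Qed.

Lemma uncountable_nonempty T (A : set T) : ~ countable A -> A !=set0.
Proof.
by move=> uA; apply/set0P/eqP => A0; apply: uA; rewrite A0; exact: countable0.
Qed.

Lemma min_wf T (lt : T -> T -> Prop) :
    (forall A : set T, A !=set0 -> exists2 x, A x & forall y, A y -> ~ lt y x) ->
  well_founded lt.
Proof.
move=> minP; apply: contrapT => /existsNP[x nx].
have [|y ny ymin] := minP [set x | ~ Acc lt x]; first by exists x.
by apply: ny; constructor => z zy; apply: contrapT => /ymin; apply.
Qed.

(** Transfinite recursion: each point in turn is sent to a member of the
    uncountable set [U] not used by its countably many predecessors. *)
Lemma greedy_injection T V (lt : T -> T -> Prop) (U : set V) :
    well_founded lt -> (forall x y, x <> y -> lt x y \/ lt y x) ->
    (forall x, countable [set y | lt y x]) -> ~ countable U ->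
  exists2 g : T -> V, injective g & forall x, U (g x).
Proof.
move=> wf tot ctb uU.
have [v0 _] := uncountable_nonempty uU.
have [pick pickP] : {pick : set V -> V &
    forall W, countable W -> (U `\` W) (pick W)}.
  apply: (@choice _ _ (fun W v => countable W -> (U `\` W) v)) => W.
  have [cW|] := pselect (countable W); last by exists v0.
  by have [v Uv] := uncountable_nonempty (uncountable_setD uU cW); exists v.
pose F x (rec : forall y, lt y x -> V) : V :=
  pick [set v | exists y (h : lt y x), rec y h = v].
pose g := Fix wf (fun=> V) F.
have gE x : g x = pick (g @` [set y | lt y x]).
  rewrite /g Fix_eq => [|z r1 r2 r12]; last first.
    by rewrite /F; congr pick; apply/seteqP; split=> v [y [h <-]]; exists y, h.
  rewrite /F; congr pick; apply/seteqP; split => v.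
    by move=> [y [h <-]]; exists y.
  by move=> [y h <-]; exists y, h.
have gP x : (U `\` (g @` [set y | lt y x])) (g x).
  by rewrite gE; apply: pickP; exact: countable_image.
exists g => [x y gxy|x]; last by case: (gP x).
apply: contrapT => /tot[] l.
- by case: (gP y) => _; apply; exists x.
- by case: (gP x) => _; apply; exists y.
Qed.

(** * The first uncountable ordinal *)

Lemma omega1_min (A : set omega1) : A !=set0 ->
  exists2 x, A x & forall y, A y -> ~ y < x.
Proof.
by move=> /omega1_wf[x Ax xmin]; exists x => // y /xmin; rewrite leNgt => /negP.
Qed.

Lemma omega1_lt_wf : well_founded (fun x y : omega1 => x < y).
Proof. exact: min_wf omega1_min. Qed.

Lemma omega1_le_countable (x : omega1) : countable [set y | y <= x].
Proof.
apply: countable_subset (countable_setU (omega1_initial_countable x) (countable1 x)).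
by move=> y /=; rewrite le_eqVlt => /orP[/eqP|]; [right|left].
Qed.

Lemma countable_bounded (A : set omega1) : countable A ->
  exists b, forall x, A x -> x < b.
Proof.
move=> cA; apply: contrapT => /forallNP nb; apply: omega1_uncountable.
apply: countable_subset (bigcup_countable cA (fun x _ => omega1_le_countable x)).
move=> b _; have /existsNP[x /not_implyP[Ax /negP]] := nb b.
by rewrite -leNgt => bx; exists x.
Qed.

Lemma omega1_gt (x : omega1) : exists y, x < y.
Proof.
by have [b xb] := countable_bounded (countable1 x); exists b; exact: xb.
Qed.

Lemma omega1_gt_uncountable (x : omega1) : ~ countable [set y | x < y].
Proof.
move=> c; apply: omega1_uncountable.
apply: countable_subset (countable_setU c (omega1_le_countable x)) => y _ /=.
by case: (ltP x y); [left|right].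
Qed.

Lemma uncountable_unbounded (A : set omega1) (x : omega1) :
  ~ countable A -> exists2 y, A y & x < y.
Proof.
move=> uA; have [y [Ay /negP]] :=
  uncountable_nonempty (uncountable_setD uA (omega1_le_countable x)).
by rewrite -ltNge; exists y.
Qed.

Definition omega1_nat_lt (x y : omega1 * nat) : Prop :=
  x.1 < y.1 \/ x.1 = y.1 /\ (x.2 < y.2)%N.

(** The lexicographic product is again a well-order with countable initial
    segments; this gives aleph_1 * aleph_0 = aleph_1. *)
Lemma omega1_nat_greedy V (U : set V) : ~ countable U ->
  exists2 g : omega1 * nat -> V, injective g & forall x, U (g x).
Proof.
apply: (@greedy_injection _ _ omega1_nat_lt).
- apply: min_wf => A [[a n] Aan].
  have [|b [m Abm] bmin] := @omega1_min [set b | exists m, A (b, m)].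
    by exists a, n.
  have exm : exists m, `[< A (b, m) >] by exists m; exact/asboolP.
  case: (ex_minnP exm) => k /asboolP Abk kmin.
  exists (b, k) => // -[c l] Acl [/= cb|[/= cb lk]].
    by apply: (bmin c) => //; exists l.
  by have := kmin l; rewrite -cb leqNgt lk => /(_ (asboolT Acl)).
- move=> [a n] [b m] ab; case: (ltgtP a b) => [?|?|E].
  + by left; left.
  + by right; left.
  + case: (ltngtP n m) => [?|?|E']; first by left; right.
      by right; right.
    by case: ab; rewrite E E'.
- move=> [b m]; apply: (@countable_subset _ _ ([set a | a <= b] `*` setT)).
    by move=> [a n] [/= /ltW|[/= -> _]].
  by apply: countableX; [exact: omega1_le_countable|exact: countableP].
Qed.

Lemma card_omega1_le V (U : set V) : ~ countable U -> [set: omega1] #<= U.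
Proof.
move=> /omega1_nat_greedy[g ginj gU].
apply/card_subP; exists (range (fun x => g (x, 0%N))).
  by apply: inj_card_eq => x y _ _ /ginj[].
by move=> _ [x _ <-].
Qed.

Lemma omega1_enum : {g : omega1 -> omega1 -> nat &
  forall b x y, x < b -> y < b -> g b x = g b y -> x = y}.
Proof.
apply: (@choice _ _ (fun b (g : omega1 -> nat) =>
  forall x y, x < b -> y < b -> g x = g y -> x = y)) => b.
have /countable_injP[g ginj] := omega1_initial_countable b.
by exists g => x y xb yb; apply: ginj; rewrite inE.
Qed.

(** * Stationary sets *)

(** [E] meets every nonzero closure point of every function, that is, every
    club set. *)
Definition stationary (E : set omega1) : Prop := forall F : omega1 -> omega1,
  exists d, [/\ E d, exists x, x < d & forall x, x < d -> F x < d].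

(** Closure points are cofinal: iterate a function dominating [F] and take the
    supremum of the iterates. *)
Lemma stationary_tail (b : omega1) : stationary [set d | b < d].
Proof.
move=> F.
have [G GP] : {G : omega1 -> omega1 &
    forall x, x < G x /\ forall y, y <= x -> F y < G x}.
  apply: (@choice _ _ (fun x z => x < z /\ forall y, y <= x -> F y < z)) => x.
  have [z zP] := countable_bounded (countable_setU (countable1 x)
    (countable_image F (omega1_le_countable x))).
  by exists z; split=> [|y yx]; apply: zP; [left|right; exists y].
pose c n := iter n G b.
have [|d cd dmin] := @omega1_wf [set d | forall n, c n < d].
  have [d dP] := countable_bounded (countable_image c (countableP setT)).
  by exists d => n; apply: dP; exists n.
exists d; split=> [||x xd]; [exact: (cd 0%N)|by exists b; exact: (cd 0%N)|].
have [n xcn] : exists n, x <= c n.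
  apply: contrapT => /forallNP nx; move: xd; apply/negP; rewrite -leNgt.
  by apply: dmin => n; rewrite ltNge; apply/negP; exact: nx.
by have [_ /(_ _ xcn)] := GP (c n); move/lt_trans; apply; exact: (cd n.+1).
Qed.

Lemma stationary_bigcup (E : nat -> set omega1) :
  stationary (\bigcup_n E n) -> exists n, stationary (E n).
Proof.
move=> sE; apply: contrapT => /forallNP nE.
have [F FP] : {F : nat -> omega1 -> omega1 & forall n, ~ exists d,
    [/\ E n d, exists x, x < d & forall x, x < d -> F n x < d]}.
  apply: (@choice _ _ (fun n F => ~ exists d,
    [/\ E n d, exists x, x < d & forall x, x < d -> F x < d])) => n.
  by have /existsNP[F] := nE n; exists F.
have [G GP] : {G : omega1 -> omega1 & forall x n, F n x < G x}.
  apply: (@choice _ _ (fun x z => forall n, F n x < z)) => x.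
  have [z zP] := countable_bounded (countable_image (F^~ x) (countableP setT)).
  by exists z => n; apply: zP; exists n.
have [d [[n _ End] d0 dG]] := sE G.
by apply: (FP n); exists d; split=> // x /dG; exact: lt_trans (GP x n).
Qed.

(** The Ulam matrix: fix injections of the initial segments of omega_1 into the
    natural numbers, and for [n] and [b] collect the [d > b] that number [b]
    by [n].  For each [b] some [n] gives a stationary set, the same [n] serves
    uncountably many [b], and the sets belonging to one [n] are disjoint.  The
    booleans give each index a pair of sets, needed in
    [stationary_antichain]. *)
Lemma disjoint_stationary_sets : exists D : omega1 * bool -> set omega1,
  (forall i, stationary (D i)) /\ (forall i j d, D i d -> D j d -> i = j).
Proof.
have [g ginj] := omega1_enum.
pose M n b : set omega1 := [set d | b < d /\ g d b = n].
have Mst b : exists n, stationary (M n b).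
  apply: stationary_bigcup => F.
  have [d [bd d0 dF]] := stationary_tail b F.
  by exists d; split=> //; exists (g d b).
have [col colP] := choice Mst.
have [n _ un] := uncountable_fiber omega1_uncountable
  (countableP [set: nat]) (fun x _ => I : setT (col x)).
have [h hinj hP] := omega1_nat_greedy un.
exists (fun i => M n (h (i.1, nat_of_bool i.2))); split=> [i|[b k] [c l] d /=].
  by have [_ <-] := hP (i.1, nat_of_bool i.2); exact: colP.
move=> [bd gb] [cd gc]; have := ginj d _ _ bd cd.
by rewrite gb gc => /(_ erefl)/hinj[->]; case: (k) (l) => [] [].
Qed.

(** * A coherent family of finite-to-one functions *)

(** The recursion [rho b x = max (g b c) (rho c x)], where [c] minimizes the
    injection [g b] on the interval [[x, b)].  Only finitely many [c] have a
    given bound on [g b c], so both properties reduce to finitely many smaller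
    instances. *)
Lemma coherent_family : {rho : omega1 -> omega1 -> nat &
  (forall b n, finite_set [set x | x < b /\ (rho b x <= n)%N]) /\
  (forall a b, a < b -> finite_set [set x | x < a /\ rho a x <> rho b x])}.
Proof.
have [g ginj] := omega1_enum.
have [st stP] : {st : omega1 * omega1 -> omega1 & forall p, p.2 < p.1 ->
    [/\ p.2 <= st p, st p < p.1 &
      forall c, p.2 <= c -> c < p.1 -> (g p.1 (st p) <= g p.1 c)%N]}.
  apply: (@choice _ _ (fun p s => p.2 < p.1 -> [/\ p.2 <= s, s < p.1 &
    forall c, p.2 <= c -> c < p.1 -> (g p.1 s <= g p.1 c)%N])) => -[b x] /=.
  have [xb|] := pselect (x < b); last by exists b.
  have exn : exists n, `[< exists c, [/\ x <= c, c < b & g b c = n] >].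
    by exists (g b x); apply/asboolP; exists x.
  case: (ex_minnP exn) => n /asboolP[c [xc cb <-]] cmin.
  exists c => _; split=> // e xe eb; apply: cmin.
  by apply/asboolP; exists e.
pose F b (rec : forall c, c < b -> omega1 -> nat) x : nat :=
  if pselect (st (b, x) < b) is left h then maxn (g b (st (b, x))) (rec _ h x)
  else 0%N.
pose rho := Fix omega1_lt_wf (fun=> omega1 -> nat) F.
have rhoE b x : x < b -> rho b x = maxn (g b (st (b, x))) (rho (st (b, x)) x).
  move=> xb; rewrite {1}/rho Fix_eq => [|z r1 r2 r12]; last first.
    by rewrite /F; apply/funext => y; case: pselect => // h; rewrite r12.
  rewrite /F; case: pselect => // h.
  by have [_ /h] := stP (b, x) xb.
have fing b n : finite_set [set c | c < b /\ (g b c <= n)%N].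
  apply/finite_set_leP; exists n.+1; apply/card_subP.
  exists (g b @` [set c | c < b /\ (g b c <= n)%N]).
    by apply: inj_card_eq => x y; rewrite !inE => -[xb _] [yb _]; exact: ginj.
  by move=> _ [c [_ cn] <-].
have rho_fin b n : finite_set [set x | x < b /\ (rho b x <= n)%N].
  elim/(well_founded_ind omega1_lt_wf): b n => b IH n.
  apply: sub_finite_set (_ : finite_set
    (\bigcup_(c in [set c | c < b /\ (g b c <= n)%N])
      ([set c] `|` [set x | x < c /\ (rho c x <= n)%N]))).
    move=> x [xb]; rewrite rhoE// geq_max => /andP[gn rn].
    have [xs sb _] := stP (b, x) xb.
    exists (st (b, x)) => //; move: xs; rewrite /= le_eqVlt => /orP[/eqP|] ?.
      by left.
    by right.
  apply: bigcup_finite => // c [cb _].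
  by rewrite finite_setU; split; [exact: finite_set1|exact: IH].
exists rho; split=> // a b; elim/(well_founded_ind omega1_lt_wf): b a => b IH a ab.
apply: sub_finite_set (_ : finite_set
  (\bigcup_(c in [set c | c < b /\ (g b c <= g b a)%N])
    ([set c] `|` ([set x | x < c /\ (rho c x <= g b c)%N] `|`
       [set x | [/\ x < c, x < a & rho c x <> rho a x]])))).
  move=> x [xa]; have xb := lt_trans xa ab.
  have [xs sb smin] := stP (b, x) xb.
  rewrite (rhoE b)// => rx; exists (st (b, x)).
    by split=> //; exact: smin (ltW xa) ab.
  move: xs; rewrite /= le_eqVlt => /orP[/eqP|xs]; first by left.
  right; have [|gr] := leqP (rho (st (b, x)) x) (g b (st (b, x))); first by left.
  by right; split=> // E; apply: rx; rewrite (maxn_idPr (ltnW gr)).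
apply: bigcup_finite => // c [cb _].
rewrite finite_setU; split; first exact: finite_set1.
rewrite finite_setU; split=> //; case: (ltgtP c a) => [ca|ac|->].
- by apply: sub_finite_set (IH a ab c ca) => x [].
- by apply: sub_finite_set (IH c cb a ac) => x [? ?] /nesym.
- by apply: sub_finite_set (finite_set0 _) => x [].
Qed.

Definition rho : omega1 -> omega1 -> nat := projT1 coherent_family.

Lemma rho_finite_to_one b n : finite_set [set x | x < b /\ rho b x = n].
Proof.
apply: sub_finite_set ((projT2 coherent_family).1 b n) => x [xb <-].
by split=> //; exact: leqnn.
Qed.

Lemma rho_coherent a b : a <= b ->
  finite_set [set x | x < a /\ rho a x <> rho b x].
Proof.
rewrite le_eqVlt => /orP[/eqP <-|/(projT2 coherent_family).2//].
by apply: sub_finite_set (finite_set0 _) => x [].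
Qed.

(** * The coherent Aronszajn tree *)

(** The tree consists of all finite modifications of the functions [rho a],
    padded with [None] from their height on. *)
Definition is_node (a : omega1) (s : omega1 -> option rat) : Prop :=
  [/\ forall x, x < a -> s x <> None, forall x, a <= x -> s x = None &
      finite_set [set x | x < a /\ s x <> Some (rho a x)%:R%R]].

(** The root is left out: it would be an endpoint of the lines below. *)
Record node := Node {
  height : omega1;
  label : omega1 -> option rat;
  label_is_node : is_node height label;
  height_gt0 : exists x, x < height }.

Definition agree (d : omega1) (s t : node) : Prop :=
  forall x, x < d -> label s x = label t x.

Lemma agree_refl d s : agree d s s. Proof. by []. Qed.

Lemma agree_sym d s t : agree d s t -> agree d t s.
Proof. by move=> st x /st. Qed.

Lemma agree_trans d t s u : agree d s t -> agree d t u -> agree d s u.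
Proof. by move=> st tu x xd; rewrite st// tu. Qed.

Lemma agree_le d d' s t : d <= d' -> agree d' s t -> agree d s t.
Proof. by move=> dd' st x xd; apply: st; exact: lt_le_trans dd'. Qed.

Lemma label_None t x : height t <= x -> label t x = None.
Proof. by have [_ H _] := label_is_node t; exact: H. Qed.

Lemma label_Some t x : x < height t -> exists q, label t x = Some q.
Proof.
by have [H _ _] := label_is_node t => /H; case: (label t x) => // q; exists q.
Qed.

Lemma agree_height d s t : agree d s t -> d <= height s -> d <= height t.
Proof.
move=> st ds; rewrite leNgt; apply/negP => td.
have [q] := label_Some (lt_le_trans td ds).
by rewrite st// label_None.
Qed.

Lemma node_eq s t : height s = height t -> agree (height s) s t -> s = t.
Proof.
case: s t => [a s sP a0] [b t tP b0] /= E; subst b; rewrite /agree /= => st.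
have E : s = t.
  apply/funext => x; case: (ltP x a) => [/st//|ax].
  by have [_ -> //] := sP; have [_ -> //] := tP.
by subst t; congr Node; exact: Prop_irrelevance.
Qed.

Lemma first_difference s t : s <> t ->
  exists x, agree x s t /\ label s x <> label t x.
Proof.
move=> st; have [|x xd xmin] := @omega1_wf [set x | label s x <> label t x].
  apply: contrapT => /set0P/negP; rewrite negbK => /eqP E; apply: st.
  have {}E x : label s x = label t x.
    by apply: contrapT => N; have : set0 x by rewrite -E.
  apply: node_eq => [|x _//]; apply/eqP; rewrite eq_le; apply/andP; split.
    by apply: (@agree_height _ s t).
  by apply: (@agree_height _ t s).
exists x; split=> // y yx; apply: contrapT => /xmin.
by rewrite leNgt yx.
Qed.

Lemma node_restrict t d : (exists x, x < d) -> d <= height t ->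
  exists2 u, height u = d & agree d u t.
Proof.
move=> d0 dt; have [tS tN tfin] := label_is_node t.
pose s x := if x < d then label t x else None.
have sP : is_node d s.
  split=> [x xd|x dx|].
  - by rewrite /s xd; apply: tS; exact: lt_le_trans dt.
  - by rewrite /s ltNge dx.
  - have := rho_coherent dt => /(conj tfin); rewrite -finite_setU.
    apply: sub_finite_set => x []; rewrite /s /= => xd; rewrite xd => nx.
    have [E|N] := pselect (rho d x = rho (height t) x); last by right.
    by left; rewrite -E; split=> //; exact: lt_le_trans dt.
by exists (Node sP d0) => // x xd; rewrite /= /s xd.
Qed.

Lemma node_graft s b x q a : is_node b s -> x <= b -> x < a ->
  exists u, [/\ height u = a, forall y, y < x -> label u y = s y &
                label u x = Some q].
Proof.
move=> [sS sN sfin] xb xa.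
pose w y := if y < x then s y else if y == x then Some q else
            if y < a then Some (rho a y)%:R%R else None.
have wP : is_node a w.
  split=> [y ya|y ay|].
  - rewrite /w; case: ifP => [yx|_]; first by apply: sS; exact: lt_le_trans xb.
    by case: ifP => //; rewrite ya.
  - have xy := lt_le_trans xa ay.
    by rewrite /w ltNge (ltW xy) /= gt_eqF// ltNge ay.
  - have := conj (finite_set1 x) (conj sfin (conj (rho_coherent xb)
      (rho_coherent (ltW xa)))); rewrite -!finite_setU.
    apply: sub_finite_set => y [ya]; rewrite /w.
    case: (ltgtP y x) => [yx sy|xy|->]; [right|by rewrite ya|by left].
    have [E|] := pselect (rho x y = rho b y); last by right; left.
    have [E'|] := pselect (rho x y = rho a y); last by right; right.
    by left; split; [exact: lt_le_trans xb|rewrite -E E'].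
have a0 : exists x, x < a by exists x.
exists (Node wP a0); split=> //= [y yx|]; first by rewrite /w yx.
by rewrite /w ltxx eqxx.
Qed.

Lemma graft t x q a : x <= height t -> x < a ->
  exists u, [/\ height u = a, agree x t u & label u x = Some q].
Proof.
move=> xt xa; have [u [ua uE uq]] := node_graft q (label_is_node t) xt xa.
by exists u; split=> // y /uE.
Qed.

Lemma node_exists : exists t : node, True.
Proof.
have [b _ bmin] := @omega1_wf setT (uncountable_nonempty omega1_uncountable).
have rootP : is_node b (fun=> None).
  split=> // [x|]; first by rewrite ltNge bmin.
  by apply: sub_finite_set (finite_set0 _) => x []; rewrite ltNge bmin.
have [a ba] := omega1_gt b.
by have [t _] := node_graft 0%R rootP (lexx b) ba; exists t.
Qed.

Lemma cone_uncountable t : ~ countable [set u | agree (height t) t u].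
Proof.
move=> /(countable_image height) c; apply: (omega1_gt_uncountable (x := height t)).
apply: countable_subset c => a /= ta.
by have [u [<- tu _]] := graft 0%R (lexx _) ta; exists u.
Qed.

(** A node of height [a] is determined by the finite graph of its deviation
    from [rho a]. *)
Lemma level_countable a : countable [set t | height t = a].
Proof.
pose dev t : set (omega1 * option rat) :=
  [set p | [/\ p.1 < a, label t p.1 = p.2 & p.2 <> Some (rho a p.1)%:R%R]].
apply: (@countable_injective _ _ _ dev); last first.
  apply: (@countable_subset _ _ [set A : set (omega1 * option rat) |
      A `<=` [set x | x < a] `*` setT /\ finite_set A]).
    move=> _ [t ta <-]; split; first by move=> [x o] [].
    have [_ _] := label_is_node t; rewrite ta.
    move=> /(finite_image (fun x => (x, label t x))); apply: sub_finite_set.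
    by move=> [x o] [/= xa <- xo]; exists x.
  apply: countable_finite_subset; apply: countableX; last exact: countableP.
  exact: omega1_initial_countable.
move=> s t; rewrite !inE /= => sa ta E; apply: node_eq; rewrite sa// => x xa.
have sub u v : dev u = dev v -> label u x <> Some (rho a x)%:R%R ->
    label u x = label v x.
  move=> uv ux; have : dev v (x, label u x) by rewrite -uv.
  by case.
have [Es|/(sub s t E)//] := pselect (label s x = Some (rho a x)%:R%R).
have [Et|/(sub t s (esym E))//] := pselect (label t x = Some (rho a x)%:R%R).
by rewrite Es Et.
Qed.

Lemma low_nodes_countable d : countable [set t | height t <= d].
Proof.
apply: countable_subset (bigcup_countable (omega1_le_countable d)
  (fun a _ => level_countable a)).
by move=> t td; exists (height t).
Qed.

Lemma low_nodes_uncountable (A : set node) d : ~ countable A ->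
  ~ countable [set t | A t /\ d <= height t].
Proof.
move=> uA c; apply: (uncountable_setD uA (low_nodes_countable d)).
apply: countable_subset c => t [At /negP]; rewrite -ltNge => /ltW.
by split.
Qed.

(** Along a cofinal branch each value would be attained only finitely often
    below every level, since this holds for each [rho d]; but then
    countably many values cannot fill omega_1. *)
Lemma no_cofinal_branch (b : omega1 -> node) : (forall x, x <= height (b x)) ->
  (forall x y, x <= y -> agree x (b x) (b y)) -> False.
Proof.
move=> bh bc; have [up upP] := choice omega1_gt.
pose v x := label (b (up x)) x.
have vE d x : x < d -> label (b d) x = v x.
  move=> xd; rewrite /v; case: (leP d (up x)) => [/bc/(_ x xd)//|/ltW/bc].
  by move=> /(_ x (upP x))/esym.
have fin q d : finite_set [set x | x < d /\ v x = Some q].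
  have [_ _ tfin] := label_is_node (b d).
  have rfin : finite_set [set x | x < height (b d) /\
      Some (rho (height (b d)) x)%:R%R = Some q].
    have [[n qn]|nq] := pselect (exists n : nat, q = n%:R%R).
      apply: sub_finite_set (rho_finite_to_one (height (b d)) n) => x [xd [E]].
      split=> //; apply/eqP; move: E; rewrite qn => /eqP.
      by rewrite Num.Theory.eqr_nat.
    apply: sub_finite_set (finite_set0 _) => x [_ [E]].
    by apply: nq; eexists; symmetry; exact: E.
  have := conj tfin rfin; rewrite -finite_setU; apply: sub_finite_set.
  move=> x [xd vx]; have xb := lt_le_trans xd (bh d).
  have [E|N] := pselect (label (b d) x = Some (rho (height (b d)) x)%:R%R).
    by right; split=> //; rewrite -E vE.
  by left.
have cnt q : countable [set x | v x = Some q].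
  apply: finite_set_countable; apply: contrapT.
  move=> /infiniteP/card_subP[C CN CV].
  have cC : countable C by rewrite (eq_countable CN); exact: countableP.
  have [d Cd] := countable_bounded cC.
  apply: infinite_nat; rewrite -(eq_finite_set CN).
  by apply: sub_finite_set (fin q d) => x Cx; split; [exact: Cd|exact: CV].
apply: omega1_uncountable.
apply: countable_subset (bigcup_countable (countableP [set: rat]) (fun q _ => cnt q)).
move=> x _; have [q E] := label_Some (lt_le_trans (upP x) (bh (up x))).
by exists q.
Qed.

(** * The lexicographic lines *)

(** [None] is the letter of a node at and above its height; the argument [bottom]
    tells on which side of the rationals it goes. *)
Definition letter_lt (bottom : bool) (o1 o2 : option rat) : bool :=
  match o1, o2 with
  | Some p, Some q => (p < q)%R
  | None, Some _ => bottom
  | Some _, None => ~~ bottom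
  | None, None => false
  end.

Lemma letter_lt_irr b o : letter_lt b o o = false.
Proof. by case: o => //= q; exact: ltxx. Qed.

Lemma letter_lt_trans b o2 o1 o3 :
  letter_lt b o1 o2 -> letter_lt b o2 o3 -> letter_lt b o1 o3.
Proof.
by case: b o1 o2 o3 => [] [p|] [q|] [r|] //=; exact: lt_trans.
Qed.

Lemma letter_lt_total b o1 o2 : o1 <> o2 -> letter_lt b o1 o2 \/ letter_lt b o2 o1.
Proof.
case: b o1 o2 => [] [p|] [q|] //= pq; try by [left|right].
all: by case: (ltgtP p q) => [||E]; [left|right|case: pq; rewrite E].
Qed.

(** Next to the endpoint [None] this uses that the rationals are unbounded. *)
Lemma letter_lt_dense b o1 o2 : letter_lt b o1 o2 ->
  exists q, letter_lt b o1 (Some q) /\ letter_lt b (Some q) o2.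
Proof.
case: b o1 o2 => [] [p|] [q|] //= pq.
- by exists ((p + q) / 2)%R; rewrite !Num.Theory.midf_lt.
- by exists (q - 1)%R; split=> //; rewrite Num.Theory.ltrBlDr Num.Theory.ltrDl.
- by exists ((p + q) / 2)%R; rewrite !Num.Theory.midf_lt.
- by exists (p + 1)%R; split=> //; rewrite Num.Theory.ltrDl.
Qed.

(** Nodes are compared at their first difference; at the levels in [S] a node
    comes before all its proper extensions, at the other levels after them. *)
Definition lex (S : set omega1) (s t : node) : Prop :=
  exists2 x, agree x s t & letter_lt (x \in S) (label s x) (label t x).

Lemma lex_irr S s : ~ lex S s s.
Proof. by move=> [x _]; rewrite letter_lt_irr. Qed.

Lemma lex_trans S t s u : lex S s t -> lex S t u -> lex S s u.
Proof.
move=> [x st xst] [y tu ytu]; case: (ltgtP x y) => [xy|yx|E].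
- exists x; last by rewrite -tu.
  by apply: agree_trans st _; exact: agree_le (ltW xy) tu.
- exists y; last by rewrite st.
  by apply: agree_trans _ tu; exact: agree_le (ltW yx) st.
- subst y; exists x; first exact: agree_trans tu.
  exact: letter_lt_trans xst ytu.
Qed.

Lemma lex_total S s t : s <> t -> lex S s t \/ lex S t s.
Proof.
move=> /first_difference[x [st /(letter_lt_total (x \in S))[]]]; [left|right].
  by exists x.
by exists x => //; exact: agree_sym.
Qed.

(** An alias of [node] for each [S], to carry the order [lex S]. *)
Definition line (S : set omega1) : Type := node.

HB.instance Definition _ (S : set omega1) := gen_eqMixin (line S).
HB.instance Definition _ (S : set omega1) := gen_choiceMixin (line S).

Definition line_lt (S : set omega1) : rel (line S) := fun s t => `[< lex S s t >].

Lemma line_lt_irr S : irreflexive (@line_lt S).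
Proof. by move=> s; apply/asboolP; exact: lex_irr. Qed.

Lemma line_lt_trans S : transitive (@line_lt S).
Proof.
by move=> t s u /asboolP st /asboolP tu; apply/asboolP; exact: lex_trans tu.
Qed.

HB.instance Definition _ (S : set omega1) :=
  Order.Lt_isPOrder.Build omega1_display (line S)
    (@line_lt_irr S) (@line_lt_trans S).

Lemma line_ltP S (s t : line S) : s < t <-> lex S s t.
Proof. by split=> /asboolP. Qed.

Lemma line_le_total S : total (<=%O : rel (line S)).
Proof.
move=> s t; case: (eqVneq s t) => [->|/eqP]; first by rewrite lexx.
by move=> /(lex_total S)[] /line_ltP/ltW ->; rewrite ?orbT.
Qed.

HB.instance Definition _ (S : set omega1) :=
  Order.POrder_isTotal.Build omega1_display (line S) (@line_le_total S).

(** Outside the cone of [s], a node lies on the same side of the whole cone. *)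
Lemma agree_convex S d (s t u : line S) :
  s <= t -> t <= u -> agree d s u -> agree d s t.
Proof.
rewrite le_eqVlt => /predU1P[-> //|/line_ltP[x st xst]] tu su.
case: (leP d x) => [dx|xd]; first exact: agree_le dx st.
have : u < t.
  apply/line_ltP; exists x; last by rewrite -su.
  by apply: agree_trans _ st; apply: agree_sym; exact: agree_le (ltW xd) su.
by rewrite ltNge tu.
Qed.

(** Two distinct nodes have a whole cone between them, rooted just above their
    first difference. *)
Lemma cone_between S (s t : line S) : s < t -> exists x,
  [/\ agree x s t, label s x <> label t x & forall a, x < a ->
    exists2 u, height u = a & forall v : line S, agree a u v -> s < v < t].
Proof.
move=> /line_ltP[x st xst]; exists x; split=> //.
  by move=> E; rewrite E letter_lt_irr in xst.
move=> a xa; have [q [sq qt]] := letter_lt_dense xst.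
have xs : x <= height s.
  rewrite leNgt; apply/negP => sx; have sN := label_None (lexx (height s)).
  have ts : height t <= height s.
    rewrite leNgt; apply/negP => /label_Some[p]; rewrite -st// sN.
    by [].
  by rewrite !label_None ?(ltW sx)// ?(le_trans ts (ltW sx)) // letter_lt_irr in xst.
have [u [ua su uq]] := graft q xs xa; exists u => // v uv.
have sv : agree x s v by apply: agree_trans su _; exact: agree_le (ltW xa) uv.
have vq : label v x = Some q by rewrite -uv.
apply/andP; split; apply/line_ltP; exists x; rewrite ?vq //.
by apply: agree_trans _ st; exact: agree_sym.
Qed.

(** At a limit level [d] the cones are told apart by the nodes of height below
    [d], because the separating cone can be rooted before [d]. *)
Lemma low_between S d (s t : line S) : (forall x, x < d -> exists2 a, x < a & a < d) ->
  s < t -> ~ agree d s t -> exists u : line S, [/\ height u < d, s < u & u < t].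
Proof.
move=> lim /cone_between[x [st _ btw]] nst.
have xd : x < d by rewrite ltNge; apply/negP => dx; apply: nst; exact: agree_le st.
have [a xa ad] := lim x xd; have [u ua /(_ u (@agree_refl a u))/andP[su ut]] := btw a xa.
by exists u; rewrite ua.
Qed.

Lemma interval_uncountable S (s t : line S) : s < t ->
  ~ countable [set u : line S | s <= u <= t].
Proof.
move=> /cone_between[x [_ _ btw]]; have [a xa] := omega1_gt x.
have [u ua uP] := btw a xa => c; apply: (@cone_uncountable u).
apply: countable_subset c => v /=; rewrite ua => /uP/andP[sv vt].
by rewrite !ltW.
Qed.

Lemma line_lt_ex S (t : line S) : exists s, s < t.
Proof.
have [x xt] := height_gt0 t; have [q tq] := label_Some xt.
have [s [_ ts sq]] := graft (q - 1)%R (ltW xt) xt.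
exists s; apply/line_ltP; exists x; first exact: agree_sym.
by rewrite sq tq /= Num.Theory.ltrBlDr Num.Theory.ltrDl.
Qed.

Lemma line_gt_ex S (t : line S) : exists s, t < s.
Proof.
have [x xt] := height_gt0 t; have [q tq] := label_Some xt.
have [s [_ ts sq]] := graft (q + 1)%R (ltW xt) xt.
exists s; apply/line_ltP; exists x => //.
by rewrite sq tq /= Num.Theory.ltrDl.
Qed.

(** The levels are countable and aleph_1 * aleph_0 = aleph_1. *)
Lemma card_nodes_le (A : set node) : A #<= [set: omega1].
Proof.
have [code codeP] : {code : omega1 -> node -> nat & forall a s t,
    height s = a -> height t = a -> code a s = code a t -> s = t}.
  apply: (@choice _ _ (fun a (code : node -> nat) => forall s t,
    height s = a -> height t = a -> code s = code t -> s = t)) => a.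
  have /countable_injP[code inj] := level_countable a.
  by exists code => s t sa ta; apply: inj; rewrite inE.
have [g ginj _] := omega1_nat_greedy omega1_uncountable.
pose h t := g (height t, code (height t) t).
apply/card_subP; exists (h @` A); last by [].
apply: inj_card_eq => s t _ _ /ginj[st]; rewrite st => E.
exact: codeP E.
Qed.

Lemma line_aleph1_dense S : aleph1_dense (line S).
Proof.
split.
- by have [t _] := node_exists; exists t.
- move=> [a amin]; have [s sa] := line_lt_ex a.
  by have := amin s; rewrite leNgt sa.
- move=> [a amax]; have [s sa] := line_gt_ex a.
  by have := amax s; rewrite leNgt sa.
- move=> a b ab; apply: Cantor_Bernstein; first exact: card_nodes_le.
  by apply: card_omega1_le; exact: interval_uncountable.
Qed.

(** * The lines are Aronszajn *)

(** Pigeonhole on the countable level [d]. *)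
Lemma uncountable_cone T (A : set T) (f : T -> node) d :
    {in A &, injective f} -> ~ countable A -> (exists x, x < d) ->
  exists2 t, height t = d & ~ countable [set a | A a /\ agree d t (f a)].
Proof.
move=> finj uA d0.
have [r rP] : {r : node -> node & forall t, d <= height t ->
    height (r t) = d /\ agree d (r t) t}.
  apply: (@choice _ _ (fun t u => d <= height t ->
    height u = d /\ agree d u t)) => t.
  have [/(node_restrict d0)[u]|] := pselect (d <= height t); first by exists u.
  by exists t.
have uB : ~ countable (f @` A) by move=> /(countable_injective finj).
have uC : ~ countable [set a | A a /\ d <= height (f a)].
  move=> c; apply: (low_nodes_uncountable uB (d := d)).
  apply: countable_subset (countable_image f c) => _ [[a Aa <-] da].
  by exists a.
have [|t td ut] := uncountable_fiber (f := r \o f) uC (level_countable d).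
  by move=> a [_ /rP[]].
exists t => // c; apply: ut; apply: countable_subset c => a [[Aa da]] /= <-.
by split=> //; have [] := rP _ da.
Qed.

(** The cones that contain uncountably many terms would form a cofinal branch.
    The betweenness hypothesis covers increasing and decreasing sequences. *)
Lemma no_convex_sequence (x : omega1 -> node) : injective x ->
    (forall a b c d, a < b -> b < c -> agree d (x a) (x c) -> agree d (x a) (x b)) ->
  False.
Proof.
move=> xinj xconv.
have [b bP] : {b : omega1 -> node & forall d, d <= height (b d) /\
    ~ countable [set a | agree d (b d) (x a)]}.
  apply: (@choice _ _ (fun d t => d <= height t /\
    ~ countable [set a | agree d t (x a)])) => d.
  (* The level [d] may be the zeroth, which has no node; [e] is not. *)
  have [e de] := omega1_gt d.
  have [||t te ut] := uncountable_cone (d := e) (f := x) _ omega1_uncountable.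
  - by move=> ? ? _ _; exact: xinj.
  - by exists d.
  exists t; rewrite te ltW//; split=> // c; apply: ut.
  by apply: countable_subset c => a [_]; exact: agree_le (ltW de).
apply: (@no_cofinal_branch b) => [d|d e de]; first by case: (bP d).
have [_ ud] := bP d; have [_ ue] := bP e.
have [a1 da1] := uncountable_nonempty ud.
have [c ec a1c] := uncountable_unbounded a1 ue.
have [a2 da2 ca2] := uncountable_unbounded c ud.
have a12 : agree d (x a1) (x a2) by apply: agree_trans _ da2; exact: agree_sym.
apply: agree_trans da1 (agree_trans (xconv _ _ _ _ a1c ca2 a12) _).
by apply: agree_sym; exact: agree_le de ec.
Qed.

Lemma ex_three_lt d (T : orderType d) (A : set T) : ~ countable A ->
  exists x y z, [/\ A x, A y, A z & x < y < z].
Proof.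
move=> uA; have [x Ax] := uncountable_nonempty uA.
have [y [Ay yx]] := uncountable_nonempty (uncountable_setD uA (countable1 x)).
have [z [Az]] := uncountable_nonempty
  (uncountable_setD uA (countable_setU (countable1 x) (countable1 y))).
move=> /not_orP[zx zy]; have {yx zx zy} : uniq [:: x; y; z].
  rewrite /= !inE !negb_or andbT; apply/andP; split; last by apply/eqP => /esym.
  by apply/andP; split; apply/eqP => /esym.
rewrite /= !inE negb_or -!andbA => /and4P[xy xz yz _].
case: (ltgtP x y) xy => // xy _; case: (ltgtP x z) xz => // xz _;
  case: (ltgtP y z) yz => // yz _.
- by exists x, y, z; rewrite xy yz.
- by exists x, z, y; rewrite xz yz.
- by have := lt_trans (lt_trans xy yz) xz; rewrite ltxx.
- by exists z, x, y; rewrite xz xy.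
- by exists y, x, z; rewrite xz xy.
- by have := lt_trans (lt_trans xz yz) xy; rewrite ltxx.
- by exists y, z, x; rewrite xz yz.
- by exists z, y, x; rewrite yz xy.
Qed.

(** One point of [X] is chosen in each rational interval that meets [X]. *)
Lemma real_countable_between (R : realType) (X : set R) : exists D : set R,
  [/\ countable D, D `<=` X & forall x y z, X y -> x < y < z ->
    exists2 d, D d & x < d < z].
Proof.
pose I (p : rat * rat) : set R :=
  [set y | X y /\ ratr p.1 < y < ratr p.2].
have [c cP] : {c : rat * rat -> R & forall p, I p !=set0 -> I p (c p)}.
  apply: (@choice _ _ (fun p y => I p !=set0 -> I p y)) => p.
  by have [[y Iy]|] := pselect (I p !=set0); [exists y|exists 0%R].
exists (c @` [set p | I p !=set0]); split.
- by apply: countable_image; exact: countableP.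
- by move=> _ [p /cP[Xc _] <-].
move=> x y z Xy /andP[/rat_in_itvoo[p] + /rat_in_itvoo[q]].
rewrite !in_itv /= => /andP[xp py] /andP[yq qz].
have ne : I (p, q) !=set0 by exists y; rewrite /I /= py yq.
exists (c (p, q)); first by exists (p, q).
have [_ /= /andP[pc cq]] := cP _ ne.
by rewrite (lt_trans xp pc) (lt_trans cq qz).
Qed.

(** A countable set dense in [X] has its image below some level [d], yet some cone
    above level [d] contains the images of three points of [X]. *)
Lemma no_real_copy (R : realType) S (X : set R) (f : R -> line S) :
  ~ countable X -> {in X &, {mono f : x y / x <= y}} -> False.
Proof.
move=> uX fmono.
have flt x y : X x -> X y -> (f x < f y) = (x < y).
  by move=> Xx Xy; rewrite !ltNge fmono ?inE.
have [D [cD DX DP]] := real_countable_between X.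
have [d dP] := countable_bounded (countable_image (@height \o f) cD).
have [e de] := omega1_gt d.
have [||t te ut] := uncountable_cone (d := e) (f := f) _ uX.
- move=> x y Xx Xy E; apply: le_anti.
  by rewrite -!fmono// E lexx.
- by exists d.
have [x [y [z [[Xx tx] [Xy _] [Xz tz] xyz]]]] := ex_three_lt ut.
have [c Dc /andP[xc cz]] := DP x y z Xy xyz.
have Xc := DX c Dc.
have xce : agree e (f x) (f c).
  apply: (@agree_convex S _ _ _ (f z)).
  - by rewrite ltW// flt.
  - by rewrite ltW// flt.
  - by apply: agree_trans _ tz; exact: agree_sym.
have := agree_height (agree_trans tx xce); rewrite te lexx => /(_ isT).
by apply/negP; rewrite -ltNge; apply: lt_trans de; apply: dP; exists c.
Qed.

Lemma line_aronszajn (R : realType) S : aronszajn_line R (line S).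
Proof.
split.
- move=> c; have [t _] := node_exists; have [u tu] := line_gt_ex (t : line S).
  by apply: (interval_uncountable tu); exact: countable_subset c.
- move=> [f fmono]; apply: (@no_convex_sequence f) => [|a b c d ab bc].
    exact: inc_inj fmono.
  by apply: agree_convex; rewrite fmono ltW.
- move=> [f fmono]; apply: (@no_convex_sequence f) => [|a b c d ab bc ac].
    exact: inc_inj fmono.
  have cb : f c <= f b by rewrite fmono; exact: ltW bc.
  have ba : f b <= f a by rewrite fmono; exact: ltW ab.
  exact: agree_trans ac (agree_convex cb ba (agree_sym ac)).
- by move=> X uX [f]; exact: no_real_copy.
Qed.

(** * Epimorphisms between lines *)

(** The cones that meet both an initial segment and its complement are linearly
    ordered by inclusion, so they cannot occur at every level. *)
Lemma cut_decided S (D : set (line S)) :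
    (forall s t, s <= t -> D t -> D s) ->
  exists d, forall s t, d <= height s -> agree d s t -> (D s <-> D t).
Proof.
move=> down; apply: contrapT => /forallNP nd.
have [b bP] : {b : omega1 -> node * node & forall d,
    [/\ d <= height (b d).1, agree d (b d).1 (b d).2, D (b d).1 & ~ D (b d).2]}.
  apply: (@choice _ _ (fun d p =>
    [/\ d <= height p.1, agree d p.1 p.2, D p.1 & ~ D p.2])) => d.
  have /existsNP[s /existsNP[t /not_implyP[ds /not_implyP[st Dst]]]] := nd d.
  have [Ds|nDs] := pselect (D s); have [Dt|nDt] := pselect (D t).
  - by case: Dst.
  - by exists (s, t).
  - by exists (t, s); split=> //=; [exact: agree_height ds|exact: agree_sym].
  - by case: Dst.
have D_lt (s t : line S) : D s -> ~ D t -> s <= t.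
  by move=> Ds nDt; rewrite leNgt; apply/negP => /ltW/down/(_ Ds).
apply: (@no_cofinal_branch (fun d => (b d).1)) => [d|d e de]; first by case: (bP d).
have [_ bd Dd nDd] := bP d; have [_ be De nDe] := bP e.
case/orP: (le_total ((b d).1 : line S) (b e).1) => [le|ge].
- exact: agree_convex le (D_lt _ _ De nDd) bd.
- apply: agree_sym; apply: agree_convex ge (D_lt _ _ Dd nDe) _.
  exact: agree_le de be.
Qed.

(** Here [s] is the root of its cone, and roots at the levels in [S] are least. *)
Lemma bottom_le S d (s t : line S) :
  d \in S -> height s = d -> agree d s t -> s <= t.
Proof.
move=> dS sd st; case: (leP (height t) d) => [td|dt].
  have -> : s = t; last by [].
  apply: node_eq; last by rewrite sd.
  apply/eqP; rewrite sd eq_le td andbT.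
  by apply: agree_height st _; rewrite sd.
have [q tq] := label_Some dt.
by apply/ltW/line_ltP; exists d; rewrite // dS tq label_None ?sd.
Qed.

(** The root of the cone is its greatest element, and below it the values at
    [d] run through the unbounded rationals. *)
Lemma cone_no_min T d (s : line T) : d \notin T -> d <= height s ->
  exists2 t : line T, agree d s t & t < s.
Proof.
move=> dT ds; have [e de] := omega1_gt d.
pose q : rat := if label s d is Some p then (p - 1)%R else 0%R.
have [t [_ st tq]] := graft q ds de; exists t => //.
apply/line_ltP; exists d; first exact: agree_sym.
rewrite (negPf dT) tq /q; case: (label s d) => //= p.
by rewrite Num.Theory.ltrBlDr Num.Theory.ltrDl.
Qed.

(** Take [d] in [S] but not in [T], closed under the heights and the cut levels
    coming from [f].  If [f b] has height at least [d], then [f] sends the node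
    of height [d] below [b], the least element of its cone in [line S], to the
    least element of the cone of [f b] at level [d] in [line T]; but that cone
    has no least element. *)
Lemma no_epi S T (f : line S -> line T) : stationary (S `\` T) ->
  {homo f : x y / x <= y} -> set_surj setT setT f -> False.
Proof.
move=> ST fhomo fsurj.
(* [c y] is a level that decides both cuts of [line S] induced by [y]. *)
have [c cP] : {c : line T -> omega1 & forall y s t, c y <= height s ->
    agree (c y) s t -> (f s < y <-> f t < y) /\ (f s <= y <-> f t <= y)}.
  apply: (@choice _ _ (fun y d => forall s t, d <= height s -> agree d s t ->
    (f s < y <-> f t < y) /\ (f s <= y <-> f t <= y))) => y.
  have [|d1 P1] := @cut_decided S [set s | f s < y].
    by move=> s t /fhomo; exact: le_lt_trans.
  have [|d2 P2] := @cut_decided S [set s | f s <= y].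
    by move=> s t /fhomo; exact: le_trans.
  exists (Order.max d1 d2) => s t; rewrite ge_max => /andP[s1 s2] st; split.
    by apply: P1 => //; apply: agree_le st; rewrite le_max lexx.
  by apply: P2 => //; apply: agree_le st; rewrite le_max lexx orbT.
have [F FP] : {F : omega1 -> omega1 & forall x, [/\ x < F x,
    forall s, height s <= x -> height (f s) < F x &
    forall y, height y <= x -> c y < F x]}.
  apply: (@choice _ _ (fun x z => [/\ x < z,
    forall s, height s <= x -> height (f s) < z &
    forall y, height y <= x -> c y < z])) => x.
  have [z zP] := countable_bounded (countable_setU (countable1 x) (countable_setU
    (countable_image (@height \o f) (low_nodes_countable x))
    (countable_image c (low_nodes_countable x)))).
  exists z; split=> [|s sx|y yx]; apply: zP; first by left.
    by right; left; exists s.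
  by right; right; exists y.
have [d [[dS dT] d0 dF]] := ST F.
have lim x : x < d -> exists2 a, x < a & a < d.
  by move=> xd; exists (F x); [case: (FP x)|exact: dF].
have flow s : height s < d -> height (f s) < d.
  by move=> sd; apply: lt_trans (dF _ sd); have [_ H _] := FP (height s); exact: H.
have fhigh s : d <= height (f s) -> d <= height s.
  by rewrite !leNgt; apply: contra => /flow.
have [a da] : exists a : line T, d <= height a.
  have [t _] := node_exists.
  have [e eP] := countable_bounded (countable_setU (countable1 d)
    (countable1 (height t))).
  have [|a [ae _ _]] := graft 0%R (lexx (height t)) (a := e).
    by apply: eP; right.
  by exists a; rewrite ae ltW//; apply: eP; left.
have [b _ fb] := fsurj a I.
have db : d <= height b by apply: fhigh; rewrite fb.
have [s sd sb] := node_restrict d0 db.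
(* [s] and [b] agree on every cut level below [d], so their images lie on the
   same side of every low [y]. *)
have same_cut y : height y < d -> (f s < y <-> a < y) /\ (f s <= y <-> a <= y).
  move=> yd; have cd : c y < d.
    by apply: lt_trans (dF _ yd); have [_ _ H] := FP (height y); exact: H.
  by rewrite -fb; apply: cP; [rewrite sd ltW|exact: agree_le (ltW cd) sb].
have fsa : agree d a (f s).
  apply: contrapT => na; case: (ltgtP a (f s)) => [as_|sa|E].
  - have [u [ud au us]] := low_between lim as_ na.
    have [_ [_ H]] := same_cut u ud.
    by have := H (ltW au); rewrite leNgt us.
  - have nsa : ~ agree d (f s) a by move=> /agree_sym.
    have [u [ud su ua]] := low_between lim sa nsa.
    have [[H _] _] := same_cut u ud.
    by have := H su; rewrite ltNge (ltW ua).
  - by apply: na; rewrite E.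
(* A smaller element [v] of the cone would have a preimage [e] below the whole
   cone of [s]; a low node between [e] and [s] would be sent into the cone of
   [f s], which contains no low node. *)
have fs_min v : agree d (f s) v -> f s <= v.
  move=> sv; rewrite leNgt; apply/negP => vs.
  have dv : d <= height v by apply: agree_height sv _; exact: agree_height fsa da.
  have [e _ fe] := fsurj v I.
  have es : e < s by rewrite ltNge; apply/negP => /fhomo; rewrite fe leNgt vs.
  have nes : ~ agree d e s.
    by move=> /agree_sym/(bottom_le (mem_set dS) sd); rewrite leNgt es.
  have [u [ud eu us]] := low_between lim es nes.
  have := flow u ud; rewrite ltNge => /negP; apply.
  apply: agree_height dv; apply: (@agree_convex T _ _ _ (f s)).
  - by rewrite -fe fhomo// ltW.
  - by rewrite fhomo// ltW.
  - exact: agree_sym.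
have [|t st] := @cone_no_min T d (f s) _ (agree_height fsa da).
  by apply/negP => /set_mem.
by rewrite ltNge (fs_min t st).
Qed.

Lemma stationary_subset E E' : E `<=` E' -> stationary E -> stationary E'.
Proof. by move=> EE' sE F; have [d [/EE']] := sE F; exists d. Qed.

Lemma line_not_epi_le S T : stationary (S `\` T) -> ~ epi_le (line T) (line S).
Proof.
move=> ST [E|[f fhomo fsurj]]; last exact: no_epi ST fhomo fsurj.
by have [t _] := node_exists; have : (set0 : set (line T)) t by rewrite -E.
Qed.

(** [X] selects one set from each pair [D (x, true)], [D (x, false)] of disjoint
    stationary sets; where [X] and [Y] choose differently, each has a
    stationary set that the other avoids. *)
Lemma stationary_antichain : exists A : set omega1 -> set omega1,
  forall X Y, X <> Y -> stationary (A X `\` A Y).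
Proof.
have [D [Dst Dinj]] := disjoint_stationary_sets.
exists (fun X => \bigcup_x D (x, x \in X)) => X Y XY.
have [x xXY] : exists x, (x \in X) <> (x \in Y).
  apply: contrapT => /forallNP E; apply: XY.
  have {}E x : (x \in X) = (x \in Y) by apply: contrapT; exact: E.
  by apply/seteqP; split=> x /mem_set; [rewrite E|rewrite -E] => /set_mem.
apply: stationary_subset (Dst (x, x \in X)) => d Dd.
split; first by exists x.
by move=> [y _ /(Dinj _ _ _ Dd)[<-]].
Qed.

(* [set omega1] is the power set of omega1, so the index type has size 2^aleph1. *)
Theorem theorem5p3 (R : realType) :
  exists (d : Order.disp_t) (L : set omega1 -> orderType d),
    (forall S, aleph1_dense (L S) /\ aronszajn_line R (L S)) /\
    (forall S T, S <> T -> ~ epi_le (L S) (L T) /\ ~ epi_le (L T) (L S)).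
Proof.
have [A AP] := stationary_antichain.
exists omega1_display, (fun S => line (A S) : orderType omega1_display).
split=> [S|S T ST]; first by split; [exact: line_aleph1_dense|exact: line_aronszajn].
by split; apply: line_not_epi_le; apply: AP => // /esym.
Qed.
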